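(* Let $E\subseteq\mathbb{R}$ be a $\rho$-statistically downward compact set and let $f:E\to\mathbb{R}$ be $\rho$-statistically downward continuous on $E$. Then $f$ is uniformly continuous on $E$.
   Context: $\rho=(\rho_n)$ is a fixed non-decreasing sequence of positive real numbers tending to $\infty$ such that $\limsup_n \rho_n/n<\infty$ and $\Delta\rho_n=O(1)$, where $\Delta\rho_n=\rho_{n+1}-\rho_n$. A sequence $(\alpha_k)_{k\ge 1}$ of real numbers is called $\rho$-statistically downward quasi-Cauchy if $\lim_{n\to\infty}\frac{1}{\rho_n}|\{k\le n:\alpha_{k+1}-\alpha_k\ge\varepsilon\}|=0$ for every $\varepsilon>0$, where $|\cdot|$ of a set is its cardinality and $k$ ranges over positive integers. A subset $E$ of $\mathbb{R}$ is $\rho$-statistically downward compact if every sequence of points in $E$ has a $\rho$-statistically downward quasi-Cauchy subsequence. A real valued function $f$ is $\rho$-statistically downward continuous on $E\subseteq\mathbb{R}$ if $(f(\alpha_k))$ is $\rho$-statistically downward quasi-Cauchy whenever $(\alpha_k)$ is a $\rho$-statistically downward quasi-Cauchy sequence of points in $E$. *)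

(* Defs.v *)
From mathcomp Require Import all_boot all_order all_algebra.
From mathcomp Require Import all_classical all_reals all_analysis.

Set Implicit Arguments.
Unset Strict Implicit.
Unset Printing Implicit Defensive.

Import Order.TTheory GRing.Theory Num.Theory.
Import numFieldNormedType.Exports.

Local Open Scope classical_set_scope.
Local Open Scope ring_scope.

(* Sequences are indexed by the positive integers: a sequence is a function on
   nat whose value at 0 is never used, and a subset E of R used as a type is
   the subtype of its points, with the uniformity induced from R. *)

(* limn_esup is the limsup in the extended reals; the last three conditions are
   asymptotic and so do not depend on the value of rho at 0. *)
Definition admissible_weight (R : realType) (rho : nat -> R) : Prop :=
  [/\ forall n, (0 < n)%N -> 0 < rho n,
      forall m n, (0 < m)%N -> (m <= n)%N -> rho m <= rho n,
      rho n @[n --> \oo] --> +oo,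
      (limn_esup (fun n => (rho n / n%:R)%:E) < +oo)%E
    & (fun n => rho n.+1 - rho n) =O_\oo (fun=> 1 : R)].

Definition stat_downward_quasi_Cauchy (R : realType) (rho : nat -> R)
    (a : nat -> R) : Prop :=
  forall eps : R, 0 < eps ->
    (rho n)^-1 *
      #|[pred k : 'I_n.+1 | (0 < k)%N && (eps <= a k.+1 - a k)]|%:R
      @[n --> \oo] --> (0 : R).

(* A strictly increasing phi on nat satisfies 0 < phi k for 0 < k, so it
   restricts to a strictly increasing map of the positive integers, and every
   such map arises in this way (take phi 0 = 0). *)
Definition stat_downward_compact (R : realType) (rho : nat -> R)
    (E : set R) : Prop :=
  forall a : nat -> E, exists phi : nat -> nat,
    {homo phi : m n / (m < n)%N} /\
    stat_downward_quasi_Cauchy rho (fun k => \val (a (phi k))).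

Definition stat_downward_continuous (R : realType) (rho : nat -> R)
    (E : set R) (f : E -> R) : Prop :=
  forall a : nat -> E,
    stat_downward_quasi_Cauchy rho (fun k => \val (a k)) ->
    stat_downward_quasi_Cauchy rho (fun k => f (a k)).

(* Main.v *)
(** If [f] is not uniformly continuous, there are points [x_n], [y_n] of [E]
    with [|x_n - y_n| -> 0] and [f y_n - f x_n >= e].  By compactness the [x_n]
    may be taken downward quasi-Cauchy, and then so is the interlaced sequence
    [x_0, y_0, x_1, y_1, ...].  Its image under [f] jumps by at least [e] at
    every even index, a set not of [rho]-density 0 because [rho n = O(n)]. *)
Require Import Defs.
From mathcomp Require Import all_boot all_order all_algebra.
From mathcomp Require Import all_classical all_reals all_analysis.
From mathcomp Require Import zify lra.
Import Order.TTheory GRing.Theory Num.Theory.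
Import numFieldNormedType.Exports.

Local Open Scope classical_set_scope.
Local Open Scope ring_scope.

Lemma leq_card_inj (T U : finType) (A : {pred T}) (B : {pred U}) (g : T -> U) :
  {in A &, injective g} -> {in A, forall x, g x \in B} -> (#|A| <= #|B|)%N.
Proof.
move=> g_inj gAB; rewrite -(card_in_image g_inj); apply: subset_leq_card.
by apply/fintype.subsetP => _ /fintype.imageP[x Ax ->]; exact: gAB.
Qed.

Definition interlace {T : Type} (x y : nat -> T) (k : nat) : T :=
  if odd k then y k./2 else x k./2.

Lemma interlace_comp (T U : Type) (g : T -> U) (x y : nat -> T) :
  (fun k => g (interlace x y k)) = interlace (g \o x) (g \o y).
Proof. by apply/funext => k; rewrite /interlace; case: ifP. Qed.

(** Halving is injective on odd numbers, so the indices of [Q] from [N] on inject into those of [P];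
    the others number at most [N]. *)
Lemma leq_card_odd_half (n N : nat) (P Q : pred nat) :
  (forall k, Q k -> (k < N)%N || odd k && P k./2) ->
  (#|[pred k : 'I_n.+1 | Q k]| <= N + #|[pred k : 'I_n.+1 | P k]|)%N.
Proof.
move=> QP.
pose A := [pred k : 'I_n.+1 | (k < N)%N].
pose B := [pred k : 'I_n.+1 | odd k && P k./2].
apply: (@leq_trans #|[predU A & B]|).
  by apply: subset_leq_card; apply/fintype.subsetP => k; rewrite !inE => /QP.
apply: leq_trans (leq_addr #|[predI A & B]| _) _.
rewrite cardUI leq_add //.
  rewrite -[leqRHS]card_ord.
  (* [inord] needs a codomain of the form ['I_N.+1], so the bound 0, where [A] is empty, is treated
     apart. *)
  case: N @A QP => [|N] A _.
    by rewrite card_ord leqn0; apply/eqP/eq_card0 => k; rewrite !inE.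
  apply: (@leq_card_in _ _ (fun k : 'I_n.+1 => inord k : 'I_N.+1)).
  move=> i j; rewrite !inE => iN jN /(congr1 val) /=.
  by rewrite !inordK // => /val_inj.
have halfK (k : 'I_n.+1) : (inord k./2 : 'I_n.+1) = k./2 :> nat.
  by rewrite inordK //; have := ltn_ord k; lia.
apply: (@leq_card_inj _ _ _ _ (fun k : 'I_n.+1 => inord k./2 : 'I_n.+1)).
  move=> i j; rewrite !inE => /andP[oi _] /andP[oj _] /(congr1 val) /=.
  by rewrite !halfK => ij; apply/val_inj => /=; lia.
by move=> k; rewrite !inE halfK => /andP[].
Qed.

(** A step from [x j] to [y j] is eventually below [e / 2]. A step from [y j] to [x j.+1] equals
    [(x j.+1 - x j) - (y j - x j)], so if it is at least [e], then [x] jumps by at least [e / 2] at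
    [j]. The finitely many early indices vanish after division by [rho n], which tends to
    infinity. *)
Lemma stat_downward_quasi_Cauchy_interlace (R : realType) (rho x y : nat -> R) :
  (forall n, (0 < n)%N -> 0 < rho n) -> rho n @[n --> \oo] --> +oo ->
  stat_downward_quasi_Cauchy rho x ->
  y k - x k @[k --> \oo] --> 0 ->
  stat_downward_quasi_Cauchy rho (interlace x y).
Proof.
move=> rho_gt0 rhoy qCx yx0 e e0; have e20 : 0 < e / 2 by lra.
have [N _ yxN] := (cvgr0Pnorm_lt _).1 yx0 _ e20.
have rhoV0 : (rho n)^-1 @[n --> \oo] --> 0.
  apply/gtr0_cvgV0 => //.
  by near do apply: rho_gt0; exact: nbhs_infty_gt.
have ub : (rho n)^-1 * (N.+1.*2)%:R + (rho n)^-1 *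
    #|[pred k : 'I_n.+1 | (0 < k)%N && (e / 2 <= x k.+1 - x k)]|%:R
    @[n --> \oo] --> (0 : R).
  rewrite -[0]add0r -{1}(mul0r (N.+1.*2)%:R).
  by apply: cvgD; [exact: cvgMl | exact: qCx].
apply: (squeeze_cvgr _ (cvg_cst 0) ub); near=> n.
have rhoV : 0 <= (rho n)^-1.
  by rewrite invr_ge0 ltW // rho_gt0 //; near: n; exact: nbhs_infty_gt.
rewrite mulr_ge0 //= -mulrDr ler_wpM2l // -natrD ler_nat.
(* The threshold [N.+1.*2] rather than [N.*2] makes [k./2] positive, as the count for [x]
   requires. *)
apply: (leq_card_odd_half n N.+1.*2
  (fun k => (0 < k)%N && (e / 2 <= x k.+1 - x k))
  (fun k => (0 < k)%N && (e <= interlace x y k.+1 - interlace x y k))).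
move=> k /andP[_]; have [//|Nk] := ltnP k N.+1.*2; rewrite /interlace /= uphalf_half.
have /yxN : (N <= k./2)%N by lia.
move=> /ltr_normlP[yx1 yx2].
case: (boolP (odd k)) => ok; rewrite ?add0n ?add1n /= => jump; last by lra.
by apply/andP; split; [lia | lra].
Unshelve. all: by end_near. Qed.

(** The limsup is an infimum, over the neighbourhoods of infinity, of suprema; one of these suprema
    must be below [+oo]. *)
Lemma limn_esup_ltyP (R : realType) (u : nat -> R) :
  (limn_esup (fun n => (u n)%:E) < +oo)%E ->
  exists2 C, 0 < C & \forall n \near \oo, u n <= C.
Proof.
move=> /ereal_inf_lt[_ [V Voo <-] supV].
have uV n : V n -> ((u n)%:E <= ereal_sup [set (u n)%:E | n in V])%E.
  by move=> Vn; apply: ereal_sup_ubound; exists n.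
move: supV uV; case: (ereal_sup _) => [s|//|] _ uV.
  (* The maximum with 1 keeps the bound positive. *)
  exists (Num.max 1 s); first by rewrite lt_max ltr01.
  by apply: filterS Voo => n /uV; rewrite lee_fin le_max => ->; rewrite orbT.
by exists 1 => //; apply: filterS Voo => n /uV.
Qed.

(** Every positive even index is a jump, so for [n >= 2] at least [n./2 >= n / 3] indices are
    counted. With [rho n <= C * n] the quotient stays at least [(3 * C)^-1]. *)
Lemma not_stat_downward_quasi_Cauchy_interlace (R : realType)
    (rho x y : nat -> R) (e : R) :
  (forall n, (0 < n)%N -> 0 < rho n) ->
  (limn_esup (fun n => (rho n / n%:R)%:E) < +oo)%E ->
  0 < e -> (forall k, e <= y k - x k) ->
  ~ stat_downward_quasi_Cauchy rho (interlace x y).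
Proof.
move=> rho_gt0 /limn_esup_ltyP[C C0 rhoC] e0 yx /(_ _ e0)/cvgr0Pnorm_lt.
have C30 : 0 < (3 * C)^-1 by rewrite invr_gt0 mulr_gt0.
move=> /(_ _ C30) small.
near \oo => n.
have n2 : (2 <= n)%N by near: n; exact: nbhs_infty_ge.
have rho0 : 0 < rho n by apply: rho_gt0; lia.
have n0 : 0 < n%:R :> R by rewrite ltr0n; lia.
have rhon : rho n <= C * n%:R.
  by rewrite -ler_pdivrMr //; near: n; exact: rhoC.
have : `|(rho n)^-1 * #|[pred k : 'I_n.+1 | (0 < k)%N &&
    (e <= interlace x y k.+1 - interlace x y k)]|%:R| < (3 * C)^-1.
  by near: n; exact: small.
set c := #|_|.
have nc : (n <= 3 * c)%N.
  suff : (n./2 <= c)%N by lia.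
  rewrite -[leqLHS]card_ord.
  have inord_double (j : 'I_n./2) : (inord j.+1.*2 : 'I_n.+1) = j.+1.*2 :> nat.
    by rewrite inordK //; have := ltn_ord j; lia.
  (* The shift to [j.+1] avoids index 0, which is not counted. *)
  apply: (@leq_card_inj _ _ _ _ (fun j : 'I_n./2 => inord j.+1.*2 : 'I_n.+1)).
    move=> i j _ _ /(congr1 val) /=; rewrite !inord_double => ij.
    by apply/val_inj => /=; lia.
  move=> j _; rewrite inE inord_double.
  by rewrite /interlace /= odd_double uphalf_double doubleK; exact: yx.
rewrite ger0_norm; last by rewrite mulr_ge0 // invr_ge0 ltW.
rewrite mulrC ltr_pdivrMr // mulrC ltr_pdivlMr ?mulr_gt0 //.
apply/negP; rewrite -leNgt.
have {}nc : n%:R <= 3 * c%:R :> R by rewrite -natrM ler_nat.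
by apply: le_trans rhon _; rewrite (mulrC _ (3 * C)) -mulrA mulrCA ler_wpM2l // ltW.
Unshelve. all: by end_near. Qed.

Lemma not_unif_continuous_seq (R : realType) (E : set R) (f : E -> R) :
  ~ unif_continuous f ->
  exists e (x y : nat -> E), [/\ 0 < e,
    (forall k, `|\val (x k) - \val (y k)| < k.+1%:R^-1) &
    (forall k, e <= f (y k) - f (x k))].
Proof.
move=> /unif_continuousP nuc.
have [e [e0 {}nuc]] : exists e, 0 < e /\ forall d, 0 < d ->
    exists xy : E * E, `|\val xy.1 - \val xy.2| < d /\ e <= f xy.2 - f xy.1.
  apply: contrapT => H; apply: nuc => e e0.
  apply: contrapT => H'; apply: H; exists e; split => // d d0.
  apply: contrapT => H; apply: H'; exists d => // -[a b] /= ab.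
  rewrite /ball /= ltNge; apply/negP => fab.
  (* The downward notion sees only increases, so the pair is ordered to make [f] increase; the
     distance is symmetric. *)
  apply: H; have [fle|flt] := leP (f a) (f b).
    by exists (a, b); split => //=; move: fab; rewrite ler0_norm; lra.
  exists (b, a); split => /=; first by rewrite distrC.
  by move: fab; rewrite gtr0_norm; lra.
have /choice[xy xyP] : forall k : nat, exists xy : E * E,
    `|\val xy.1 - \val xy.2| < k.+1%:R^-1 /\ e <= f xy.2 - f xy.1.
  by move=> k; apply: nuc; rewrite invr_gt0 ltr0n.
by exists e, (fst \o xy), (snd \o xy); split => // k; have [] := xyP k.
Qed.

Theorem theorem4 (R : realType) (rho : nat -> R) (E : set R) (f : E -> R) :
  admissible_weight rho ->
  stat_downward_compact rho E ->
  stat_downward_continuous rho f ->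
  unif_continuous f.
Proof.
move=> [rho_gt0 _ rhoy rho_lin _] Ecompact fcont.
apply: contrapT => /not_unif_continuous_seq[e [x [y [e0 xy fxy]]]].
have [phi [phi_incr qCx]] := Ecompact x.
(* This carries the bound [(phi k).+1%:R^-1] on the distances along the subsequence over to
   [k.+1%:R^-1]. *)
have phi_ge k : (k <= phi k)%N.
  by elim: k => // k IH; apply: leq_ltn_trans IH (phi_incr _ _ _).
apply: (@not_stat_downward_quasi_Cauchy_interlace _ rho
  (f \o (x \o phi)) (f \o (y \o phi)) e) => //=.
(* Interlacing commutes with [f] and with [\val], so continuity applies to the interlaced sequence
   of points of [E]. *)
rewrite -interlace_comp; apply: fcont; rewrite interlace_comp.
apply: stat_downward_quasi_Cauchy_interlace => //=.
apply/cvgr0Pnorm_lt => d d0; near=> k.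
rewrite distrC; apply: lt_le_trans (xy _) _.
have dk : k.+1%:R^-1 < d by near: k; exact: (near_infty_natSinv_lt (PosNum d0)).
by apply: le_trans (ltW dk); rewrite lef_pV2 ?posrE ?ltr0n // ler_nat ltnS.
Unshelve. all: by end_near. Qed.
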